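(* Let $X$ be a topological space and let $\mathcal{O}$ be the set of open covers of $X$. Then $\mathsf{S}_{\mathrm{bnd}}(\mathcal{O},\mathcal{O})$ holds if, and only if, $\mathsf{S}_1(\mathcal{O},\mathcal{O})\,\mathrm{mod}\,1$ holds.
   Context: Here $\omega=\{0,1,2,\dots\}$. Let $\mathcal{A},\mathcal{B}$ be families of sets. $\mathsf{S}_{\mathrm{bnd}}(\mathcal{A},\mathcal{B})$ holds if for every sequence $\langle A_n:n\in\omega\rangle$ of elements of $\mathcal{A}$ there are a sequence $\langle B_n:n\in\omega\rangle$ and a $k\in\omega$ such that $B_n\subset A_n$ is finite with $|B_n|\le k$ for every $n\in\omega$, and $\bigcup_{n\in\omega}B_n\in\mathcal{B}$. $\mathsf{S}_1(\mathcal{A},\mathcal{B})\,\mathrm{mod}\,1$ holds if for every sequence $\langle A_n:n\in\omega\rangle$ of elements of $\mathcal{A}$ there is a sequence $\langle B_n:n\in\omega\rangle$ such that $B_n\subset A_n$ is finite for every $n\in\omega$, $|B_n|\le 1$ for every $n\ge 1$, and $\bigcup_{n\in\omega}B_n\in\mathcal{B}$. *)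

(* Defs.v *)
From mathcomp Require Import all_boot all_classical topology.

Set Implicit Arguments.
Unset Strict Implicit.
Unset Printing Implicit Defensive.

Local Open Scope classical_set_scope.
Local Open Scope card_scope.

Definition open_covers (X : topologicalType) : set (set (set X)) :=
  [set U | U `<=` open /\ \bigcup_(V in U) V = [set: X]].

(* `I_k is the set of the natural numbers less than k, so that B #<= `I_k
   reads |B| <= k. *)
Definition S_bnd (T : Type) (A B : set (set T)) : Prop :=
  forall An : nat -> set T, (forall n, A (An n)) ->
  exists (Bn : nat -> set T) (k : nat),
    (forall n, [/\ Bn n `<=` An n, finite_set (Bn n) & Bn n #<= `I_k]) /\
    B (\bigcup_n Bn n).

Definition S_1_mod_1 (T : Type) (A B : set (set T)) : Prop :=
  forall An : nat -> set T, (forall n, A (An n)) ->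
  exists Bn : nat -> set T,
    [/\ forall n, Bn n `<=` An n /\ finite_set (Bn n),
        forall n, (1 <= n)%N -> Bn n #<= `I_1 &
        B (\bigcup_n Bn n)].

(* Main.v *)
Require Import Defs.
From mathcomp Require Import all_boot all_classical topology.

(** If a selection picks finitely many sets from the zeroth cover and at most
    one from each later cover, then a single number bounds all its sizes; this
    is the easy direction.

    For the converse, the bound [k] provided by the bounded principle depends
    on the sequence to which that principle is applied, so this sequence must
    be prepared for every possible [k] at once.  Given open covers [A_0, A_1,
    ...], the positive indices contain disjoint blocks of every size: the
    [n]-th block consists of [slot n j] for [j <= n], where [slot] is an
    injective coding of pairs.  Let [V_n] be a common open refinement of [A_0]
    and of the covers of the [n]-th block ([common_refinement_cover]), and let
    the bounded principle choose at most [k] elements of each [V_n].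
    - When [n >= k], the block has more than [k] covers, so the chosen elements
      of [V_n] can be enlarged to elements of different covers of the block.
    - The finitely many elements chosen from [V_n] with [n < k] are enlarged
      to elements of [A_0], from which finitely many choices are permitted.
    The enlarged sets cover at least what the chosen sets covered. *)

Set Implicit Arguments.
Unset Strict Implicit.
Unset Printing Implicit Defensive.

Local Open Scope classical_set_scope.
Local Open Scope card_scope.

Lemma card_leI_injP (T : Type) (A : set T) (k : nat) :
  A #<= `I_k -> exists e : T -> nat, set_fun A `I_k e /\ set_inj A e.
Proof. by move=> /pcard_leP/injfunPex[e eA ei]; exists e. Qed.

Lemma subsingleton_card_leI1 (T : Type) (A : set T) :
  (forall x y, A x -> A y -> x = y) -> A #<= `I_1.
Proof.
move=> Aeq; apply/pcard_leP/injfunPex; exists (fun=> 0%N) => // x y.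
by rewrite !inE => Ax Ay _; exact: Aeq.
Qed.

Definition slot (n j : nat) : nat := (pickle (n, j)).+1.

Lemma slot_inj n j m i : slot n j = slot m i -> n = m /\ j = i.
Proof. by move=> [/(pcan_inj pickleK)[-> ->]]. Qed.

Definition refines (X : Type) (A : set (set X)) (W : set X) : Prop :=
  exists2 U, A U & W `<=` U.

(** At a point, intersect one neighbourhood from each of the finitely many
    covers.  Allowing all open sets that refine the covers, instead of such
    intersections only, avoids indexing the families of chosen sets. *)
Lemma common_refinement_cover (X : topologicalType) (A : nat -> set (set X))
    (s : seq nat) :
  (forall n, open_covers (A n)) ->
  open_covers [set W | open W /\ forall i, i \in s -> refines (A i) W].
Proof.
move=> Aco; split=> [W []//|]; apply/seteqP; split=> // x _.
elim: s => [|i s [W [oW Ws] Wx]].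
  by exists setT => //; split=> //; exact: openT.
have [Ao Ac] := Aco i.
have [U AU Ux] : (\bigcup_(V in A i) V) x by rewrite Ac.
exists (W `&` U) => //; split=> [|j]; first exact: openI oW (Ao _ AU).
rewrite inE => /orP[/eqP->|/Ws[V AV WV]]; first by exists U => // y [].
by exists V => // y [/WV].
Qed.

Lemma S_1_mod_1_S_bnd (T : Type) (A B : set (set T)) :
  S_1_mod_1 A B -> S_bnd A B.
Proof.
move=> S1 An /S1[Bn [Bsub B1 BB]].
have /finite_setP[m B0m] := (Bsub 0%N).2.
exists Bn, (maxn m 1); split=> // n; have [BA Bfin] := Bsub n; split=> //.
case: n {BA Bfin} => [|n].
  apply: (@card_le_trans _ _ _ `I_m); last by rewrite card_le_II leq_maxl.
  by move: B0m; rewrite card_eq_le => /andP[].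
apply: (@card_le_trans _ _ _ `I_1); last by rewrite card_le_II leq_maxr.
exact: B1.
Qed.

Lemma S_bnd_S_1_mod_1 (X : topologicalType) :
  S_bnd (@open_covers X) (@open_covers X) ->
  S_1_mod_1 (@open_covers X) (@open_covers X).
Proof.
move=> Sb An Aco.
pose block n := 0%N :: [seq slot n j | j <- iota 0 n.+1].
have [Wn [k [Wsub [_ Wcov]]]] :=
  Sb _ (fun n => common_refinement_cover (block n) Aco).
have /choice[e eP] n : exists e : set X -> nat,
    set_fun (Wn n) `I_k e /\ set_inj (Wn n) e.
  by apply: card_leI_injP; have [] := Wsub n.
have /choice[g gP] (p : nat * set X) : exists U, refines (An p.1) p.2 ->
    An p.1 U /\ p.2 `<=` U.
  have [[U AU WU]|nr] := pselect (refines (An p.1) p.2); first by exists U.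
  by exists setT.
have W0 n W : Wn n W -> refines (An 0%N) W.
  move=> WnW; have [/(_ _ WnW)[_ /(_ 0%N)] + _ _] := Wsub n.
  by apply; rewrite inE.
have Wslot n W : (k <= n)%N -> Wn n W -> refines (An (slot n (e n W))) W.
  move=> kn WnW; have [/(_ _ WnW)[_ /(_ (slot n (e n W)))] + _ _] := Wsub n.
  apply; rewrite inE; apply/orP; right; apply: map_f.
  have := (eP n).1 _ WnW; rewrite mem_iota add0n leq0n => ek.
  exact: leq_trans ek (leqW kn).
pose early := [set g (0%N, W) | W in \bigcup_(n in `I_k) Wn n].
pose late i := [set U | exists n W,
  [/\ (k <= n)%N, Wn n W, i = slot n (e n W) & U = g (i, W)]].
pose Bn i := if i is 0 then early else late i.
(* Injectivity of [slot] recovers both [n] and the label [e n W] from the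
   index, and [e n] separates the elements of [Wn n]. *)
have late_eq i U V : late i U -> late i V -> U = V.
  move=> [n [W [_ WnW -> ->]]] [m [W' [_ WmW' /slot_inj[nm eW] ->]]].
  rewrite -nm in WmW' eW *; congr (g (_, _)).
  by apply: (eP n).2 => //; rewrite inE.
have late1 i : late i #<= `I_1.
  by apply: subsingleton_card_leI1 => U V; exact: late_eq.
have BnA i : Bn i `<=` An i.
  case: i => [U [W [n _ WnW] <-]|i U [n [W [kn WnW iE ->]]]].
    exact: (gP (0%N, W) (W0 _ _ WnW)).1.
  by have [] := gP (i.+1, W); rewrite //= iE; exact: Wslot.
exists Bn; split.
- move=> i; split; first exact: BnA.
  case: i => [|i]; last exact: card_le_finite (late1 _) (finite_II 1).
  apply: finite_image; apply: bigcup_finite; first exact: finite_II.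
  by move=> n _; have [] := Wsub n.
- by case=> [//|i _]; exact: late1.
- split=> [U [i _ /BnA]|]; first exact: (Aco i).1.
  apply/seteqP; split=> // x _.
  have [W [n _ WnW] Wx] : (\bigcup_(V in \bigcup_n Wn n) V) x by rewrite Wcov.
  have [nk|kn] := ltnP n k.
    exists (g (0%N, W)); last exact: (gP (0%N, W) (W0 _ _ WnW)).2.
    by exists 0%N => //; exists W => //; exists n.
  exists (g (slot n (e n W), W)).
    by exists (slot n (e n W)) => //; exists n, W.
  exact: (gP (slot n (e n W), W) (Wslot _ _ kn WnW)).2.
Qed.

Theorem theorem4p12 (X : topologicalType) :
  S_bnd (@open_covers X) (@open_covers X) <->
  S_1_mod_1 (@open_covers X) (@open_covers X).
Proof.
split; first exact: S_bnd_S_1_mod_1.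
exact: S_1_mod_1_S_bnd.
Qed.
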